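(* For all $n\ge0$, the lattice $L_n$ of arithmetic progressions in $[n]$ is comodernistic.
   Context: $L_n$ is the set of all subsets of $[n]=\{1,\ldots,n\}$ that are arithmetic progressions $\{a,a+r,\ldots,a+(k-1)r\}$ ($a$, $r\ge1$, $k\ge0$ integers; including $\emptyset$, singletons and $2$-element subsets), ordered by inclusion; $L_0=\{\emptyset\}$. An element $m$ of a lattice $L$ is left-modular in $L$ if for all $x<y$ in $L$, $(x\vee m)\wedge y=x\vee(m\wedge y)$. A lattice is comodernistic if every interval $[x,y]$ of it has a coatom (element covered by $y$ in $[x,y]$) which is left-modular in the lattice $[x,y]$. *)

(* Defs.v *)
From HB Require Import structures.
From mathcomp Require Import all_boot all_order.
From mathcomp Require Import boolp.

Set Implicit Arguments.
Unset Strict Implicit.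
Unset Printing Implicit Defensive.

Import Order.TTheory.

Section Comodernistic.
Local Open Scope order_scope.

Definition left_modular d (L : latticeType d) (m : L) : Prop :=
  forall x y : L, x < y -> (x `|` m) `&` y = x `|` (m `&` y).

Definition covered_by d (P : porderType d) (x y : P) : Prop :=
  x < y /\ forall z : P, ~ (x < z /\ z < y).

Definition coatom d (P : porderType d) (c : P) : Prop :=
  exists2 t : P, (forall z : P, z <= t) & covered_by c t.

Record closed_interval d (L : latticeType d) (x y : L) := ClosedInterval {
  interval_val :> L;
  _ : x <= interval_val <= y }.

Section IntervalLattice.
Context d (L : latticeType d) (x y : L).

HB.instance Definition _ := [isSub for @interval_val d L x y].
HB.instance Definition _ := [Choice of closed_interval x y by <:].

Fact interval_meet_closed : meet_closed [pred z | x <= z <= y].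
Proof.
move=> u v /andP[xu uy] /andP[xv vy].
by rewrite inE lexI xu xv leIxl.
Qed.

Fact interval_join_closed : join_closed [pred z | x <= z <= y].
Proof.
move=> u v /andP[xu uy] /andP[xv vy].
by rewrite inE leUx uy vy lexUl.
Qed.

HB.instance Definition _ := Order.SubChoice_isSubLattice.Build
  d L _ d (closed_interval x y) interval_meet_closed interval_join_closed.

End IntervalLattice.

(* One-element intervals have no coatom, so only x < y is considered. *)
Definition comodernistic d (L : latticeType d) : Prop :=
  forall x y : L, x < y ->
  exists m : closed_interval x y, coatom m /\ left_modular m.

End Comodernistic.

(* The ordinal i : 'I_n stands for the element i.+1 of [n] = {1, ..., n}. *)
Definition is_ap n (A : {set 'I_n}) : Prop :=
  exists a r k : nat, 0 < r /\
  [seq (val i).+1 | i in A] =i [seq a + j * r | j <- iota 0 k].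

Lemma is_apE n (A : {set 'I_n}) :
  is_ap A <->
  A = set0 \/ exists c r M, [/\ 0 < r, M < n & forall i : 'I_n,
    (i \in A) = (c <= i <= M) && (r %| i - c)].
Proof.
split=> [[a [r [[|k] [r0 eA]]]]|[->|[c [r [M [r0 Mn eA]]]]]].
- left; apply/setP=> i; rewrite inE; apply/negP=> iA.
  by have := eA i.+1; rewrite in_nil image_f.
- right.
  have apA j : j <= k -> exists2 i : 'I_n, i \in A & a + j * r = i.+1.
    move=> jk; apply/imageP; rewrite eA; apply/mapP; exists j => //.
    by rewrite mem_iota.
  have [i0 i0A] := apA 0 isT; rewrite mul0n addn0 => ai0.
  exists i0, r, (i0 + k * r); split=> //.
    have [i1 _] := apA k (leqnn _); rewrite ai0 addSn => -[->].
    exact: ltn_ord.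
  move=> i; have <- : (i.+1 \in [seq (val i).+1 | i in A]) = (i \in A).
    apply/imageP/idP => [[i' i'A [/val_inj->]]//|iA]; by exists i.
  rewrite eA; apply/mapP/andP => [[j]|[/andP[i0i iM]]].
    rewrite mem_iota add0n ltnS /= => jk; rewrite ai0 addSn => -[->].
    by rewrite leq_addr leq_add2l leq_mul2r jk orbT addKn dvdn_mull.
  case/dvdnP=> j ej; exists j; last by rewrite -ej ai0 addSn subnKC.
  by rewrite mem_iota add0n ltnS /= -(leq_pmul2r r0) -ej leq_subLR.
- exists 0, 1, 0; split=> // x.
  by rewrite in_nil; apply/imageP=> -[i]; rewrite inE.
- have [cM|Mc] := leqP c M; last first.
    exists 0, 1, 0; split=> // x.
    rewrite in_nil; apply/imageP=> -[i]; rewrite eA => /andP[/andP[ci iM] _] _.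
    by have := leq_trans Mc (leq_trans ci iM); rewrite ltnn.
  exists c.+1, r, ((M - c) %/ r).+1; split=> // x.
  apply/imageP/mapP => [[i]|[j]].
    rewrite eA => /andP[/andP[ci iM] /dvdnP[j ej] ->]; exists j.
      by rewrite mem_iota add0n ltnS leq_divRL //= -ej leq_sub2r.
    by rewrite -ej addSn subnKC.
  rewrite mem_iota add0n ltnS leq_divRL //= leq_subRL // => jM ->.
  exists (Ordinal (leq_ltn_trans jM Mn)) => //.
  by rewrite eA /= leq_addr jM addKn dvdn_mull.
Qed.

Lemma is_apI n (A B : {set 'I_n}) : is_ap A -> is_ap B -> is_ap (A :&: B).
Proof.
move=> /is_apE[-> _|[c [r [M [r0 Mn eA]]]]].
  by rewrite set0I; apply/is_apE; left.
move=> /is_apE[->|[d [s [N [s0 Nn eB]]]]].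
  by rewrite setI0; apply/is_apE; left.
apply/is_apE; have [->|/set0Pn[i1 i1AB]] := eqVneq (A :&: B) set0; first by left.
right; have [i0 i0AB i0min] := arg_minnP (fun i : 'I_n => val i) i1AB.
exists i0, (lcmn r s), (minn M N); split.
- by rewrite lcmn_gt0 r0.
- by rewrite gtn_min Mn.
have /setIP[] := i0AB; rewrite eA eB.
move=> /andP[/andP[ci0 i0M] ri0] /andP[/andP[di0 i0N] si0] i.
rewrite in_setI eA eB.
have [i0i|ii0] := leqP i0 i; last first.
  rewrite /=; apply/negP; rewrite -eA -eB -in_setI => /i0min.
  by rewrite /= leqNgt ii0.
rewrite (leq_trans ci0 i0i) (leq_trans di0 i0i) /= leq_min dvdn_lcm.
have e_sub e : e <= i0 -> i - e = (i - i0) + (i0 - e).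
  by move=> ei0; rewrite addnBA // subnK.
by rewrite (e_sub _ ci0) (e_sub _ di0) !dvdn_addl // andbACA.
Qed.

Lemma is_apT n : is_ap [set: 'I_n].
Proof.
case: n => [|n]; apply/is_apE.
  by left; apply/setP=> -[].
by right; exists 0, 1, n; split=> // i; rewrite inE dvd1n leq_ord.
Qed.

Record ap_lattice (n : nat) := ArithProg {
  ap_set :> {set 'I_n};
  _ : `[< is_ap ap_set >] }.

Section APLattice.
Variable n : nat.
Implicit Types A B C : ap_lattice n.

HB.instance Definition _ := [isSub for @ap_set n].
HB.instance Definition _ := [Finite of ap_lattice n by <:].

Lemma ap_setP A : is_ap A.
Proof. by case: A => A /= /asboolP. Qed.

Definition ap_le A B : bool := (A : {set 'I_n}) \subset B.

Fact ap_le_refl : reflexive ap_le.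
Proof. by move=> A; apply: subxx. Qed.

Fact ap_le_anti : antisymmetric ap_le.
Proof. by move=> A B AB; apply/val_inj/eqP; rewrite eqEsubset. Qed.

Fact ap_le_trans : transitive ap_le.
Proof. by move=> A B C; apply: subset_trans. Qed.

Fact ap_display : Order.disp_t. Proof. exact: Order.Disp tt tt. Qed.

HB.instance Definition _ := Order.Le_isPOrder.Build ap_display (ap_lattice n)
  ap_le_refl ap_le_anti ap_le_trans.

Definition ap_meet A B : ap_lattice n :=
  ArithProg (asboolT (is_apI (ap_setP A) (ap_setP B))).

Fact ap_bigcap (P : pred (ap_lattice n)) :
  is_ap (\bigcap_(C : ap_lattice n | P C) (C : {set 'I_n})).
Proof.
elim/big_ind: _ => [|A B|C _]; [exact: is_apT|exact: is_apI|exact: ap_setP].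
Qed.

Definition ap_join A B : ap_lattice n :=
  ArithProg (asboolT (ap_bigcap (fun C => ap_le A C && ap_le B C))).

Fact ap_meetP A B C : ap_le A (ap_meet B C) = ap_le A B && ap_le A C.
Proof. exact: subsetI. Qed.

Fact ap_joinP A B C : ap_le (ap_join A B) C = ap_le A C && ap_le B C.
Proof.
apply/idP/idP => [jC|ABC]; last exact: bigcap_inf.
apply/andP; split; apply: ap_le_trans jC; apply/bigcapsP => D /andP[] //.
Qed.

HB.instance Definition _ := Order.POrder_MeetJoin_isLattice.Build
  ap_display (ap_lattice n) ap_meetP ap_joinP.

End APLattice.

(* Main.v *)
(* In an interval [X, Y], either some extreme point e of Y is not in X, and then
   Y \ {e} is a left-modular coatom, or X contains both extreme points c and M
   of Y.  In the latter case every member of [X, Y] is {i in [c, M] | r %| i - c}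
   for some r, so that [X, Y] is anti-isomorphic to an interval of the
   divisibility order, and any member whose step is a prime multiple of the step
   of Y is a left-modular coatom. *)
Require Import Defs.
From mathcomp Require Import all_boot all_order.
From mathcomp Require Import boolp.

Set Implicit Arguments.
Unset Strict Implicit.
Unset Printing Implicit Defensive.

Import Order.TTheory Order.SubPreorderTheory.

(** * A lattice-theoretic criterion for left-modular coatoms *)

Section LeftModularCoatom.
Local Open Scope order_scope.

(* The hypothesis for b = y says that m is a coatom; when a <= m, left
   modularity at a < b is automatic. *)
Lemma left_modular_coatomP d (L : latticeType d) (x y m : L) :
    x <= m -> m < y ->
    (forall a b : L, x <= a -> a <= b -> b <= y -> ~~ (a <= m) ->
       b <= a `|` (m `&` b)) ->
  exists m' : closed_interval x y, coatom m' /\ left_modular m'.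
Proof.
move=> xm my H.
have xmy : x <= m <= y by rewrite xm ltW.
have xyy : x <= y <= y by rewrite lexx (le_trans xm (ltW my)).
exists (ClosedInterval xmy); split.
  exists (ClosedInterval xyy) => [z|].
    by rewrite -Order.le_val; have /andP[] := valP z.
  split=> [|z]; first by rewrite -lt_val.
  have /andP[xz zy] := valP z; rewrite -!lt_val /= => -[mz zlty].
  have := H _ y xz zy (lexx y); rewrite (meet_l (ltW my)) (join_l (ltW mz)).
  by rewrite (lt_geF mz) (lt_geF zlty) => /(_ isT).
move=> a' b'; rewrite -lt_val => ab'; apply: val_inj.
have /andP[xa' _] := valP a'; have /andP[_ bY'] := valP b'.
move: ab' xa' bY'; rewrite /=.
move: (interval_val a') (interval_val b') => a b ab xa bY.
have [am|nam] := boolP (a <= m).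
  by rewrite (join_r am) (join_r (_ : a <= m `&` b)) // lexI am ltW.
have bj := H a b xa (ltW ab) bY nam.
(* Both sides of the modular identity equal [b], since [b] lies below the join of [a] and [m]. *)
have -> : a `|` (m `&` b) = b.
  by apply/le_anti; rewrite bj leUx (ltW ab) leIr.
by apply/meet_r/(le_trans bj); rewrite leUx leUl (le_trans (leIl _ _) (leUr _ _)).
Qed.

End LeftModularCoatom.

(** * Progressions with prescribed extreme points *)

Definition ap_between n (c M r : nat) : {set 'I_n} :=
  [set i : 'I_n | (c <= i <= M) && (r %| i - c)].

Section ArithmeticProgressions.
Variable n : nat.
Implicit Types (A B X Y : {set 'I_n}) (c M e r : nat).

Lemma is_ap_between c M r : 0 < r -> M < n -> is_ap (ap_between n c M r).
Proof.
by move=> r0 Mn; apply/is_apE; right; exists c, r, M; split=> // i; rewrite inE.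
Qed.

(** The bounds [c'], [M'] given by [is_apE] can be replaced by [c] and [M]: as [r] divides [c - c'],
    the residue condition may be measured from [c]. *)
Lemma is_ap_extremes A (c M : 'I_n) :
    is_ap A -> c \in A -> M \in A -> {in A, forall i : 'I_n, c <= i <= M} ->
  exists2 r, 0 < r & A = ap_between n c M r.
Proof.
move=> /is_apE[->|[c' [r [M' [r0 M'n eA]]]]]; first by rewrite inE.
rewrite !eA => /andP[/andP[c'c cM'] rc] /andP[/andP[c'M MM'] rM] ext.
exists r => //; apply/setP=> i; rewrite inE.
have e_sub : c <= i -> i - c' = (i - c) + (c - c').
  by move=> ci; rewrite addnBA // subnK.
apply/idP/idP => [iA|/andP[/andP[ci iM] ri]].
  have /andP[ci iM] := ext i iA; rewrite ci iM /=.
  by move: iA; rewrite eA e_sub // dvdn_addl // => /andP[].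
by rewrite eA (leq_trans c'c ci) (leq_trans iM MM') e_sub // dvdn_add.
Qed.

(** It suffices to test the second element [c + e], which is at most [M] because [e] divides the
    positive number [M - c]. *)
Lemma ap_between_sub c M e r : c < M -> M < n -> 0 < e -> e %| M - c ->
  (ap_between n c M e \subset ap_between n c M r) = (r %| e).
Proof.
move=> cM Mn e0 eM; apply/subsetP/idP => [sub|re i]; last first.
  by rewrite !inE => /andP[-> /(dvdn_trans re)].
have ceM : c + e <= M.
  by rewrite -leq_subRL ?(ltnW cM) // dvdn_leq // subn_gt0.
have := sub (Ordinal (leq_ltn_trans ceM Mn)).
by rewrite !inE /= leq_addr ceM addKn dvdnn => /(_ isT).
Qed.

Lemma is_ap_ltn M : is_ap [set i : 'I_n | i < M].
Proof.
apply/is_apE; have [le_nM|] := leqP n M; last first.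
  case: M => [|M] Mn; first by left; apply/setP=> i; rewrite !inE.
  by right; exists 0, 1, M; split=> [||i] //; [exact: ltnW|rewrite inE dvd1n andbT].
apply/is_apE; suff -> : [set i : 'I_n | i < M] = setT by exact: is_apT.
by apply/setP=> i; rewrite !inE (leq_trans (ltn_ord i)).
Qed.

Lemma is_ap_gtn c : is_ap [set i : 'I_n | c < i].
Proof.
have [n0|n_gt0] := posnP n.
  apply/is_apE; left; apply/setP=> i.
  by have n_gt0 := leq_ltn_trans (leq0n i) (ltn_ord i); rewrite n0 in n_gt0.
apply/is_apE; right; exists c.+1, 1, n.-1; split=> // [|i].
  by rewrite prednK.
by rewrite inE dvd1n andbT -(ltnS i) prednK // ltn_ord andbT.
Qed.

(** Removing the greatest element amounts to intersecting with an initial segment, itself a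
    progression. *)
Lemma is_apD1_max A (M : 'I_n) :
  is_ap A -> {in A, forall i : 'I_n, i <= M} -> is_ap (A :\ M).
Proof.
move=> apA maxM.
suff -> : A :\ M = A :&: [set i : 'I_n | i < M] by exact/is_apI/is_ap_ltn.
apply/setP=> i; rewrite !inE andbC; have [/maxM|//] := boolP (i \in A).
by rewrite ltn_neqAle => ->; rewrite andbT.
Qed.

Lemma is_apD1_min A (c : 'I_n) :
  is_ap A -> {in A, forall i : 'I_n, c <= i} -> is_ap (A :\ c).
Proof.
move=> apA minc.
suff -> : A :\ c = A :&: [set i : 'I_n | c < i] by exact/is_apI/is_ap_gtn.
apply/setP=> i; rewrite !inE andbC; have [/minc|//] := boolP (i \in A).
by rewrite ltn_neqAle => ->; rewrite andbT eq_sym.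
Qed.

End ArithmeticProgressions.

(** Write [a = a' * b]. The lcm divides [p * b], and [p] does not divide [a'], for otherwise [r * p]
    would divide [a]. So [s] divides the gcd of [a' * b] and [p * b], which is [b]. *)
Lemma dvdn_of_mul_lcmn p r a b s : prime p -> r %| b -> b %| a ->
  ~~ (r * p %| a) -> s %| a -> s %| lcmn (r * p) b -> s %| b.
Proof.
move=> pp rb /dvdnP[a' ->] nrpa sa sl.
have spb : s %| p * b.
  apply: dvdn_trans sl _; rewrite dvdn_lcm (mulnC r) dvdn_pmul2l ?prime_gt0 //.
  by rewrite rb dvdn_mull.
have cpa : coprime a' p.
  rewrite coprime_sym prime_coprime //; apply: contra nrpa => pa.
  by rewrite mulnC dvdn_mul.
have: s %| gcdn (a' * b) (p * b) by rewrite dvdn_gcd sa.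
by rewrite -muln_gcdl (eqP cpa) mul1n.
Qed.

(** * The two kinds of left-modular coatoms *)

Section Coatoms.
Variable n : nat.
Implicit Types X Y : ap_lattice n.
Local Open Scope order_scope.

Lemma ap_leE X Y : (X <= Y) = ((X : {set 'I_n}) \subset Y).
Proof. by []. Qed.

Lemma ap_ltE X Y : (X < Y) = ((X : {set 'I_n}) \proper Y).
Proof. by rewrite lt_leAnge !ap_leE properE. Qed.

Lemma ap_meetE X Y : (X `&` Y : ap_lattice n) = X :&: Y :> {set 'I_n}.
Proof. by []. Qed.

(** If [A] is not contained in [Y :\ e], then [e] is in [A], so [A] and [B :\ e] together already
    cover [B]. *)
Lemma left_modular_coatom_D1 X Y (e : 'I_n) :
    X < Y -> e \in (Y : {set 'I_n}) -> e \notin (X : {set 'I_n}) ->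
    is_ap ((Y : {set 'I_n}) :\ e) ->
  exists m : closed_interval X Y, coatom m /\ left_modular m.
Proof.
move=> XY eY eX apD.
apply: (@left_modular_coatomP _ _ X Y (ArithProg (asboolT apD))).
- by rewrite ap_leE subsetD1 eX andbT -ap_leE ltW.
- by rewrite ap_ltE properD1.
move=> A B _ AB BY; rewrite ap_leE subsetD1 -ap_leE (le_trans AB BY) /= negbK.
move=> eA; set m := ArithProg _; rewrite ap_leE; apply/subsetP=> i iB.
have AC : A <= A `|` (m `&` B) := leUl _ _.
have mBC : m `&` B <= A `|` (m `&` B) := leUr _ _.
have [->|ie] := eqVneq i e; first exact: (subsetP AC).
apply: (subsetP mBC); rewrite ap_meetE !inE ie iB andbT.
exact: (subsetP BY).
Qed.

Lemma left_modular_coatom_extremes X Y (c M : 'I_n) :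
    X < Y -> c \in (X : {set 'I_n}) -> M \in (X : {set 'I_n}) ->
    {in (Y : {set 'I_n}), forall i : 'I_n, (c <= i <= M)%N} ->
  exists m : closed_interval X Y, coatom m /\ left_modular m.
Proof.
move=> XY cX MX ext.
have step Z : X <= Z -> Z <= Y ->
    exists2 r, (0 < r)%N & (Z : {set 'I_n}) = ap_between n c M r.
  move=> XZ ZY; apply: is_ap_extremes; first exact: ap_setP.
  - exact: (subsetP XZ).
  - exact: (subsetP XZ).
  - by move=> i iZ; apply/ext/(subsetP ZY).
have dvdM Z r : X <= Z -> (Z : {set 'I_n}) = ap_between n c M r ->
    (r %| M - c)%N.
  by move=> XZ eZ; have := subsetP XZ _ MX; rewrite eZ inE => /andP[].
have [r r0 eY] := step Y (ltW XY) (lexx _).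
have [d d0 eX] := step X (lexx _) (ltW XY).
(* Otherwise [Y] would be the single point [c], which [X] contains. *)
have cM : (c < M)%N.
  rewrite ltnNge; apply/negP => Mc; have := XY; rewrite ap_ltE.
  case/properP=> _ [i iY /negP]; apply.
  have /andP[ci iM] := ext _ iY; have -> // : i = c.
  by apply/val_inj/eqP; rewrite eqn_leq ci (leq_trans iM Mc).
have sub e s := @ap_between_sub n c M e s cM (ltn_ord M).
have dM := dvdM X d (lexx _) eX; have rM := dvdM Y r (ltW XY) eY.
have : (r %| d)%N by rewrite -(sub d) // -eX -eY -ap_leE ltW.
(* Taking [p] to divide [q = d / r] makes the progression of step [r * p] contain [X]. Here [q] is
   nonzero because [d] is positive, and [q] is not 1 because [X] differs from [Y]. *)
case/dvdnP=> q dE; set p := pdiv q.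
have pp : prime p.
  apply: pdiv_prime; case: q @p dE => [|[|//]] _ dE; first by rewrite dE in d0.
  by move: XY; rewrite ap_ltE eX eY dE mul1n properxx.
have rp0 : (0 < r * p)%N by rewrite muln_gt0 r0 prime_gt0.
have rpd : (r * p %| d)%N by rewrite dE mulnC dvdn_mul // pdiv_dvd.
have rpM : (r * p %| M - c)%N := dvdn_trans rpd dM.
apply: (@left_modular_coatomP _ _ X Y
  (ArithProg (asboolT (is_ap_between c rp0 (ltn_ord M))))).
- by rewrite ap_leE /= eX sub.
- rewrite ap_ltE /= eY properE !sub // dvdn_mulr //=.
  by rewrite -{2}(muln1 r) dvdn_pmul2l // Euclid_dvd1.
move=> A B XA AB BY nAm; set m := ArithProg _; set C := A `|` _.
have XB := le_trans XA AB; have AC : A <= C := leUl _ _.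
have mBC : m `&` B <= C := leUr _ _; have XC := le_trans XA AC.
have CB : C <= B by rewrite leUx AB leIr.
have [a a0 eA] := step A XA (le_trans AB BY).
have [b b0 eB] := step B XB BY.
have [s s0 eC] := step C XC (le_trans CB BY).
have aM := dvdM A a XA eA; have bM := dvdM B b XB eB.
have l0 : (0 < lcmn (r * p) b)%N by rewrite lcmn_gt0 rp0.
(* Inclusion reverses divisibility of steps, so the claim is that the step [s] of the join divides
   the step [b] of [B]. *)
rewrite ap_leE eB eC sub //.
apply: (@dvdn_of_mul_lcmn p r a) => //.
- by rewrite -(sub b) // -eB -eY.
- by rewrite -(sub a) // -eA -eB.
- by rewrite -(sub a) // -eA; apply: nAm.
- by rewrite -(sub a) // -eA -eC.
(* The meet of [m] and [B] has step [lcmn (r * p) b]. *)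
rewrite -(sub (lcmn (r * p) b)) ?dvdn_lcm ?rpM // -eC.
apply: subset_trans mBC; rewrite ap_meetE eB /=.
apply/subsetP=> i; rewrite !inE dvdn_lcm.
by case/andP=> -> /andP[-> ->].
Qed.

End Coatoms.

Theorem theorem11 (n : nat) : comodernistic (ap_lattice n).
Proof.
move=> X Y XY.
(* Strict inclusion makes [Y] nonempty, so that it has a least element [c] and a greatest element
   [M]. *)
have [i0 i0Y _] : exists2 i, i \in (Y : {set 'I_n}) & i \notin (X : {set 'I_n}).
  by move: XY; rewrite ap_ltE => /properP[].
have [c cY minc] := arg_minnP (fun i : 'I_n => val i) i0Y.
have [M MY maxM] := arg_maxnP (fun i : 'I_n => val i) i0Y.
have [MX|MX] := boolP (M \in (X : {set 'I_n})); last first.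
  by apply: (left_modular_coatom_D1 XY MY MX); apply: is_apD1_max (ap_setP Y) _.
have [cX|cX] := boolP (c \in (X : {set 'I_n})); last first.
  by apply: (left_modular_coatom_D1 XY cY cX); apply: is_apD1_min (ap_setP Y) _.
apply: (left_modular_coatom_extremes XY cX MX) => i iY.
by rewrite minc //; apply: maxM.
Qed.
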